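(* Consider the problem of minimizing $T_{\mathrm{mix}}$ among all (irreducible) birth-and-death chains on $\mathcal{X}=\{0,\ldots,n\}$ with initial state $0$ and symmetric kernel. (a) If $n\ge2$ is even, then the uniform chain is the unique minimizing chain. (b) If $n$ is odd, then $$p_k=\begin{cases}1-\theta_n,&\text{if } k \text{ is even},\\ \theta_n,&\text{if } k\text{ is odd}\end{cases}\qquad(k=0,\ldots,n-1)$$ gives the unique minimizing chain, where for any $m$ we define $$\theta_{m-1}:=\tfrac16\left[\sqrt{(m^2+2)(m^2-4)}-(m^2-4)\right].$$
   Context: Chains are discrete-time. A birth-and-death chain on $\{0,\ldots,n\}$ has kernel $K$ with $K(i,j)=0$ whenever $|i-j|>1$ (arbitrary holding allowed); the kernel is symmetric if $K(i,j)=K(j,i)$. A symmetric birth-and-death kernel is determined by $p_k=K(k,k+1)=K(k+1,k)$, $k=0,\ldots,n-1$, with $K(k,k)=1-p_{k-1}-p_k$ where $p_{-1}=p_n=0$; its stationary distribution (when irreducible) is uniform. The uniform chain is the one with $p_k=1/2$ for all $k=0,\ldots,n-1$. For an irreducible finite-state Markov chain $X$ with stationary distribution $\pi$ (and a given initial state), the Lovász–Winkler mixing time is $T_{\mathrm{mix}}(X)=\inf\mathbf{E}S$, where the infimum is over randomized stopping times $S$ (stopping times with respect to the chain's filtration enlarged by independent randomness) such that $X_S$ has distribution $\pi$. *)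

(* Defs.v *)
From mathcomp Require Import all_boot all_order all_algebra.
From mathcomp Require Import all_classical all_reals all_analysis.

Set Implicit Arguments.
Unset Strict Implicit.
Unset Printing Implicit Defensive.

Import Order.TTheory GRing.Theory Num.Theory.

Local Open Scope classical_set_scope.
Local Open Scope ring_scope.

Section Kernels.
Context {R : realType} {n : nat}.
Implicit Types (K : 'M[R]_n.+1) (pi : 'rV[R]_n.+1).

Definition stochastic K : Prop :=
  (forall i j, 0 <= K i j) /\ (forall i, \sum_j K i j = 1).

Definition irreducible K : Prop :=
  forall i j, exists t : nat, 0 < (K ^+ t) i j.

Definition birth_death K : Prop :=
  forall i j : 'I_n.+1, (i.+1 < j)%N || (j.+1 < i)%N -> K i j = 0.

Definition symmetric_kernel K : Prop := forall i j, K i j = K j i.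

Definition stationary K pi : Prop :=
  [/\ forall i, 0 <= pi ord0 i, \sum_i pi ord0 i = 1 & pi *m K = pi].

Definition symmetric_bd_chain K : Prop :=
  [/\ stochastic K, birth_death K, symmetric_kernel K & irreducible K].

End Kernels.

(* Only p 0, ..., p n.-1 matter: the two guards in the holding probability
   implement the convention p_{-1} = p_n = 0. *)
Definition bd_kernel (R : realType) (n : nat) (p : nat -> R) : 'M[R]_n.+1 :=
  \matrix_(i, j)
    if j == i.+1 :> nat then p i
    else if i == j.+1 :> nat then p j
    else if i == j
    then 1 - (if i == 0 :> nat then 0 else p i.-1)
           - (if i == n :> nat then 0 else p i)
    else 0.

Section MixingTime.
Context {R : realType} {n : nat}.
Implicit Types (K : 'M[R]_n.+1) (x : nat -> 'I_n.+1).

Section Process.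
Context {d : measure_display} {Omega : measurableType d}.
Context (P : probability Omega R).
Implicit Types (X : nat -> Omega -> 'I_n.+1) (S : Omega -> option nat).

Definition history X x (t : nat) : set Omega :=
  [set w | forall s, (s <= t)%N -> X s w = x s].

Definition markov_chain K (x0 : 'I_n.+1) X : Prop :=
  [/\ forall t i, measurable (X t @^-1` [set i]),
      P (X 0%N @^-1` [set x0]) = 1%E
    & forall x t, P (history X x t.+1) =
        (P (history X x t) * (K (x t) (x t.+1))%:E)%E].

Definition sigma_upto X (t : nat) : set (set Omega) :=
  <<s [set A | exists s i, (s <= t)%N /\ A = X s @^-1` [set i]] >>.

Definition sigma_process X : set (set Omega) :=
  <<s [set A | exists s i, A = X s @^-1` [set i]] >>.

(* A sigma-algebra H of extra randomness, independent of the whole chain. *)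
Definition independent_randomness X (H : set (set Omega)) : Prop :=
  [/\ sigma_algebra setT H, H `<=` measurable
    & forall A B, sigma_process X A -> H B ->
        P (A `&` B) = (P A * P B)%E].

(* None encodes the value +oo. *)
Definition stopping_time (F : nat -> set (set Omega)) S : Prop :=
  forall t, F t [set w | if S w is Some s then (s <= t)%N else false].

Definition randomized_stopping_time X S : Prop :=
  exists2 H : set (set Omega), independent_randomness X H &
    stopping_time (fun t => <<s sigma_upto X t `|` H >>) S.

(* As pi has total mass 1, this forces S to be almost surely finite. *)
Definition stopped_law X S (pi : 'rV[R]_n.+1) : Prop :=
  forall i, P [set w | if S w is Some s then X s w = i else False] =
    (pi ord0 i)%:E.

Definition mean_time S : \bar R :=
  (\int[P]_w (if S w is Some s then s%:R%:E else +oo))%E.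

End Process.

(* Lovász–Winkler mixing time; the probability space ranges over all those
   carrying the chain, so that any independent randomness is available.  For
   irreducible K the stationary law pi is unique. *)
Definition Tmix K (x0 : 'I_n.+1) : \bar R :=
  ereal_inf [set e | exists (d : measure_display) (Omega : measurableType d)
      (P : probability Omega R) (X : nat -> Omega -> 'I_n.+1)
      (S : Omega -> option nat) (pi : 'rV[R]_n.+1),
    [/\ markov_chain P K x0 X, randomized_stopping_time P X S,
        stationary K pi, stopped_law P X S pi & e = mean_time P S]].

Definition Tmix_minimizer K : Prop :=
  symmetric_bd_chain K /\
  forall K', symmetric_bd_chain K' -> (Tmix K ord0 <= Tmix K' ord0)%E.

Definition unique_Tmix_minimizer K : Prop :=
  forall K', Tmix_minimizer K' <-> K' = K.

End MixingTime.

Definition theta_pred (R : realType) (m : nat) : R :=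
  6^-1 * (Num.sqrt ((m%:R ^+ 2 + 2) * (m%:R ^+ 2 - 4)) - (m%:R ^+ 2 - 4)).

(* The defining formula is naturally indexed by m: theta (m - 1) = theta_pred m. *)
Definition theta (R : realType) (n : nat) : R := theta_pred R n.+1.

(* Main.v *)
From HB Require Import structures.
Require Import Defs.
From mathcomp Require Import all_boot all_order all_algebra.
From mathcomp Require Import all_classical all_reals all_analysis.
From mathcomp Require Import measurable_realfun zify ring lra.

(** Write p_k for the rate across the edge {k, k+1} and
    phi(x) = sum_(k < x) (k+1)/p_k, which is the mean time the chain needs to
    go from 0 to x.  The mixing time from 0 is the mean of phi under the
    uniform law,
      Tmix = sum_x phi(x)/(n+1) = sum_(k < n) (k+1)(n-k) / ((n+1) p_k),
    and the theorem follows by minimising this explicit function.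

    Lower bound (Tmix_ge).  The function phi satisfies K phi <= phi + 1, with
    equality except at n.  Hence phi(X_t) - t is a supermartingale, also in the
    filtration enlarged by independent randomness, and every randomized
    stopping time S with X_S uniform satisfies
    E S >= E phi(X_S) - phi(0) = sum_x phi(x)/(n+1).

    Upper bound (Tmix_le).  Choose a uniform target J independently of the
    chain and stop when the chain first reaches J.  Since a birth-and-death
    chain started at 0 cannot jump over J, the equality K phi = phi + 1 holds
    at every state visited before stopping, so the lower bound is attained.
    This rule needs a probability space carrying the whole chain and J.  The
    chain is coded by a uniform point of [0, 1[: nested subintervals, whose
    lengths are the probabilities of the finite histories, are split according
    to the kernel.  Two independent copies of [0, 1[ carry the chain and J.

    Optimisation (weighted_inverse_min).  With w_k = (k+1)(n-k), the convex
    function sum_k w_k/p_k is minimised under p_k + p_(k+1) <= 1 by exhibiting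
    nonnegative Lagrange multipliers f_1, ..., f_(n-1) for these constraints:
    with f_0 = f_n = 0 they must satisfy f_k + f_(k+1) = w_k / a_k^2 at the
    minimiser a.  The boundary conditions force the alternating sum of the
    w_k / a_k^2 to vanish.  For even n the symmetry w_k = w_(n-1-k) makes this
    true for the constant rate 1/2; for odd n it is the equation
    theta^2 (N^2 + 2) = (1 - theta)^2 (N^2 - 4), with N = n + 1, that defines
    theta.  When n = 1 there is no pair of edges, and the minimum is at rate
    one.  Strict convexity of p |-> 1/p gives uniqueness. *)

Import Order.TTheory GRing.Theory Num.Theory.

Local Open Scope classical_set_scope.
Local Open Scope ring_scope.

(** * Minimising the cost over feasible rates *)

Section Optimisation.
Context {R : realType}.
Implicit Types (n : nat) (w p a f : nat -> R).

(** Expanding each term at [a k] by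
    1/p = 1/a - (p - a)/a^2 + (p - a)^2/(a^2 p), the first-order terms are
    summed by parts against the multipliers [f] and the constraints make them
    nonpositive in total, so that only the quadratic remainders survive. *)
Lemma weighted_inverse_gap n w p a f :
  (forall k, (k < n)%N -> 0 < p k) -> (forall k, (k < n)%N -> 0 < a k) ->
  (forall k, 0 <= f k) -> f 0%N = 0 -> f n = 0 ->
  (forall k, (k < n)%N -> f k + f k.+1 = w k / a k ^+ 2) ->
  (forall k, (k.+1 < n)%N -> p k + p k.+1 <= a k + a k.+1) ->
  \sum_(k < n) w k * (p k - a k) ^+ 2 / (a k ^+ 2 * p k)
    <= \sum_(k < n) w k / p k - \sum_(k < n) w k / a k.
Proof.
move=> p0 a0 f0 f00 fn fE pa.
have sumle0 : \sum_(k < n) w k / a k ^+ 2 * (p k - a k) <= 0.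
  (* Summation by parts: [f 0 = f n = 0] leaves one term per constraint. *)
  under eq_bigr => k _ do rewrite -fE// mulrDl.
  rewrite big_split/=.
  case: n => [|n] in p0 a0 fn fE pa *; first by rewrite !big_ord0 addr0.
  rewrite big_ord_recl big_ord_recr/= f00 fn !mul0r add0r addr0 -big_split/=.
  apply: sumr_le0 => k _; rewrite -mulrDr mulr_ge0_le0//.
  have := pa k; rewrite ltnS => /(_ (ltn_ord k)); lra.
rewrite -subr_ge0 -sumrB -sumrB; rewrite -oppr_ge0 -sumrN in sumle0.
apply: le_trans sumle0 _; rewrite le_eqVlt; apply/orP; left; apply/eqP.
apply: eq_bigr => k _; have := p0 k (ltn_ord k); have := a0 k (ltn_ord k).
by move=> /lt0r_neq0 ? /lt0r_neq0 ?; field; apply/andP.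
Qed.

(** Uniqueness comes from the quadratic remainder of [weighted_inverse_gap]:
    it vanishes only at [p = a]. *)
Lemma weighted_inverse_min n w p a f :
  (forall k, (k < n)%N -> 0 < w k) ->
  (forall k, (k < n)%N -> 0 < p k) -> (forall k, (k < n)%N -> 0 < a k) ->
  (forall k, 0 <= f k) -> f 0%N = 0 -> f n = 0 ->
  (forall k, (k < n)%N -> f k + f k.+1 = w k / a k ^+ 2) ->
  (forall k, (k.+1 < n)%N -> p k + p k.+1 <= a k + a k.+1) ->
  \sum_(k < n) w k / a k <= \sum_(k < n) w k / p k ?= iff
    [forall k : 'I_n, p k == a k].
Proof.
move=> w0 p0 a0 f0 f00 fn fE pa.
have gap := weighted_inverse_gap _ _ _ _ _ p0 a0 f0 f00 fn fE pa.
have term_ge0 (k : 'I_n) : true ->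
    0 <= w k * (p k - a k) ^+ 2 / (a k ^+ 2 * p k).
  move=> _; have w0k := ltW (w0 k (ltn_ord k)).
  have p0k := ltW (p0 k (ltn_ord k)).
  by apply: divr_ge0; apply: mulr_ge0 => //; exact: sqr_ge0.
split; first by rewrite -subr_ge0; apply: le_trans gap; exact: sumr_ge0.
apply/eqP/forallP => [eq_sum k|eq_pa]; last first.
  by apply: eq_bigr => k _; rewrite (eqP (eq_pa k)).
have : \sum_(k < n) w k * (p k - a k) ^+ 2 / (a k ^+ 2 * p k) == 0.
  by rewrite eq_le sumr_ge0// andbT (le_trans gap)// eq_sum subrr.
rewrite psumr_eq0// => /allP /(_ k (mem_index_enum k)) /=.
have w0k := lt0r_neq0 (w0 k (ltn_ord k)).
have p0k := lt0r_neq0 (p0 k (ltn_ord k)).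
have a0k := lt0r_neq0 (a0 k (ltn_ord k)).
rewrite !(mulf_eq0, invr_eq0, expf_eq0)/= (negPf w0k) (negPf p0k) (negPf a0k).
by rewrite /= ?orbF ?orbb subr_eq0.
Qed.

(** Up to the factor [1/(n+1)], this is the mixing time from [0] of the chain
    with rates [p]. *)
Definition bd_cost n p : R :=
  \sum_(k < n) (k.+1%:R * (n - k)%:R) / p k.

(** The rates are positive and the holding probabilities nonnegative.  The bound
    by one expresses the latter at the end points, where only one edge is
    incident; for [n = 1] it is the whole constraint. *)
Definition bd_feasible n p : Prop :=
  (forall k, (k < n)%N -> 0 < p k <= 1) /\
  (forall k, (k.+1 < n)%N -> p k + p k.+1 <= 1).

Let weight_gt0 n k : (k < n)%N -> 0 < k.+1%:R * (n - k)%:R :> R.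
Proof. by move=> kn; rewrite mulr_gt0// ltr0n ?subn_gt0. Qed.

(** The recursion [f k + f k.+1 = 4 (k+1)(n-k)] is solved by a quadratic
    polynomial plus a term that alternates between two values.  Since [0] and
    [n] have the same parity, both boundary conditions hold at once. *)
Lemma bd_cost_min_even n p : ~~ odd n -> bd_feasible n p ->
  bd_cost n (fun=> 2^-1) <= bd_cost n p ?= iff [forall k : 'I_n, p k == 2^-1].
Proof.
move=> evn [p01 p1].
have p0 k (kn : (k < n)%N) : 0 < p k by case/andP: (p01 k kn).
(* Beyond [n] the formula would be negative; the truncation makes [0 <= f]
   hold everywhere. *)
pose f m : R := if (m <= n)%N then
  2 * m%:R * (n%:R - m%:R) + 2 * (n%:R + 1) * (odd m)%:R else 0.
apply: (@weighted_inverse_min n (fun k => k.+1%:R * (n - k)%:R) p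
  (fun=> 2^-1) f) => //.
- by move=> k /weight_gt0.
- move=> k; rewrite /f; case: ifP => // kn.
  by rewrite addr_ge0 ?mulr_ge0 ?subr_ge0 ?ler_nat ?addr_ge0.
- by rewrite /f leq0n/= !mulr0 mul0r addr0.
- by rewrite /f leqnn subrr !mulr0 (negPf evn) mulr0 addr0.
- move=> k kn; rewrite /f (ltnW kn) kn natrB ?(ltnW kn)//= -!natr1.
  by case: (odd k) => /=; field.
- by move=> k kn; have := p1 k kn; lra.
Qed.

(** The displayed equation is the balance condition under which the
    multipliers of the odd case vanish at both ends, since
    [N (N^2 + 2) / 12] and [N (N^2 - 4) / 12] are the sums of the weights over
    even and over odd [k]. *)
Lemma theta_balance n (N : R := n.+1%:R) : (2 < n)%N ->
  [/\ 0 < theta R n, theta R n < 1 &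
     theta R n ^+ 2 * (N ^+ 2 + 2) = (1 - theta R n) ^+ 2 * (N ^+ 2 - 4)].
Proof.
move=> n2.
have N4 : 4 <= N by rewrite ler_nat.
rewrite /theta /theta_pred -/N.
set s := Num.sqrt _.
have prod_ge0 : 0 <= (N ^+ 2 + 2) * (N ^+ 2 - 4) by nra.
have sE : s ^+ 2 = (N ^+ 2 + 2) * (N ^+ 2 - 4) by rewrite sqr_sqrtr.
have s0 : 0 <= s by exact: sqrtr_ge0.
have lo : N ^+ 2 - 4 < s by rewrite -(@ltr_pXn2r _ 2)// ?nnegrE ?sE//; nra.
have hi : s <= N ^+ 2 - 1 by rewrite -(@ler_pXn2r _ 2)// ?nnegrE ?sE//; nra.
split; [by lra | by lra |].
set u := N ^+ 2 in sE *.
(* Both squares become affine in [s] once [s ^+ 2] is eliminated. *)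
have -> : 6^-1 * (s - (u - 4)) = (s - u + 4) / 6 by field.
have -> : 1 - (s - u + 4) / 6 = (u + 2 - s) / 6 by field.
have -> : ((s - u + 4) / 6) ^+ 2 =
    ((u + 2) * (u - 4) - 2 * (u - 4) * s + (u - 4) ^+ 2) / 36.
  by rewrite -sE; field.
have -> : ((u + 2 - s) / 6) ^+ 2 =
    ((u + 2) * (u - 4) - 2 * (u + 2) * s + (u + 2) ^+ 2) / 36.
  by rewrite -sE; field.
by field.
Qed.

(** Both the recursion and its data are invariant under the reflection
    [m -> n - m], which exchanges even and odd [m].  It therefore suffices to
    solve it on even [m], where the solution is the cubic [g] up to a factor. *)
Lemma bd_cost_min_odd n p : odd n -> (2 < n)%N -> bd_feasible n p ->
  let a k := if odd k then theta R n else 1 - theta R n in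
  bd_cost n a <= bd_cost n p ?= iff [forall k : 'I_n, p k == a k].
Proof.
move=> oddn n2 [p01 p1] a.
have p0 k (kn : (k < n)%N) : 0 < p k by case/andP: (p01 k kn).
have [th0 th1 thE] := theta_balance n n2.
set th := theta R n in th0 th1 thE a *.
have N4 : 4 <= n.+1%:R :> R by rewrite ler_nat.
have nE : n%:R = n.+1%:R - 1 :> R by rewrite -natr1 addrK.
set N := n.+1%:R in thE N4 nE. clearbody th N.
have a0 k : 0 < a k by rewrite /a; case: ifP => _ //; lra.
pose g (x : R) := x * (3 * N * x - 2 * x ^+ 2 + 2 + (n%:R - x) * (N ^+ 2 + 2)).
have g0 x : 0 <= x <= n%:R -> 0 <= g x.
  move=> /andP[x0 xn]; rewrite /g mulr_ge0// addr_ge0//; first by nra.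
  by rewrite mulr_ge0 ?subr_ge0//; nra.
pose c := (2 * (th ^+ 2 * (N ^+ 2 + 2)))^-1.
have c0 : 0 < c by rewrite invr_gt0; nra.
pose f m : R := if (m <= n)%N then
  c * g (if odd m then n%:R - m%:R else m%:R) else 0.
apply: (@weighted_inverse_min n (fun k => k.+1%:R * (n - k)%:R) p a f) => //.
- by move=> k /weight_gt0.
- move=> k; rewrite /f; case: ifP => // kn; apply: mulr_ge0; first exact: ltW.
  have k0 : 0 <= k%:R :> R by []; have kn' : k%:R <= n%:R :> R by rewrite ler_nat.
  by apply: g0; case: ifP => _; apply/andP; split; lra.
- by rewrite /f leq0n/= /g mul0r mulr0.
- by rewrite /f leqnn oddn subrr /g mul0r mulr0.
- move=> k kn; rewrite /f (ltnW kn) kn natrB ?(ltnW kn)//= -!natr1 /a /c /g nE.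
  have N20 : N ^+ 2 + 2 != 0 by apply: lt0r_neq0; nra.
  have N40 : N ^+ 2 - 4 != 0 by apply: lt0r_neq0; nra.
  have th00 : th != 0 by exact: lt0r_neq0.
  have th10 : 1 - th != 0 by apply: lt0r_neq0; lra.
  case: (odd k) => /=; first by field; apply/andP.
  by rewrite thE; field; apply/andP.
- move=> k kn; apply: le_trans (p1 k kn) _; rewrite /a /=.
  by case: (odd k) => /=; lra.
Qed.
End Optimisation.

(** * Symmetric birth-and-death kernels *)

Section BirthDeathKernels.
Context {R : realType}.
Implicit Types (n : nat) (p f : nat -> R).

Lemma sum_ord_nat_eq n (m : nat) f :
  \sum_(j < n) (if j == m :> nat then f j else 0) = if (m < n)%N then f m else 0.
Proof.
case: ifP => mn; last first.
  apply: big1 => j _; case: eqP => // jm.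
  by move: (ltn_ord j); rewrite jm mn.
rewrite (bigD1 (Ordinal mn))//= eqxx big1 ?addr0// => j.
by rewrite -val_eqE/= => /negPf ->.
Qed.

(** All computations with the kernel go through its action on functions, which
    is a weighted discrete Laplacian; by symmetry it also describes the action
    on measures. *)
Lemma bd_kernel_action n p f (i : 'I_n.+1) :
  \sum_j bd_kernel n p i j * f j = f i
    + (if i == n :> nat then 0 else p i * (f i.+1 - f i))
    + (if i == 0%N :> nat then 0 else p i.-1 * (f i.-1 - f i)).
Proof.
pose hold := 1 - (if i == 0%N :> nat then 0 else p i.-1)
               - (if i == n :> nat then 0 else p i).
have split_row (j : 'I_n.+1) : bd_kernel n p i j * f j =
    (if j == i.+1 :> nat then p i * f j else 0) +
    (if j == i :> nat then hold * f j else 0) +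
    (if j == i.-1 :> nat then (if i == 0%N :> nat then 0 else p j * f j) else 0).
  have ijE : (i == j) = (j == i :> nat) by rewrite eq_sym.
  rewrite mxE ijE /hold {ijE}.
  have := ltn_ord i; case: (nat_of_ord i) => [|k] /=; move=> _;
    case: (nat_of_ord j) => [|l] /=; rewrite ?eqSS /=;
    do ?case: eqP => //=; try lia;
    by move=> *; subst; ring.
under eq_bigr => j _ do rewrite split_row.
rewrite !big_split/= (sum_ord_nat_eq _ _ (fun j => p i * f j)).
rewrite (sum_ord_nat_eq _ _ (fun j => hold * f j)).
rewrite (sum_ord_nat_eq _ _
  (fun j => if i == 0%N :> nat then 0 else p j * f j)).
rewrite ltn_ord (leq_ltn_trans (leq_pred i) (ltn_ord i)) /hold.
rewrite ltnS ltn_neqAle -ltnS ltn_ord andbT.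
by case: (nat_of_ord i == n); case: eqP => _ /=; ring.
Qed.

Lemma bd_kernel_sym n p : symmetric_kernel (bd_kernel n p).
Proof.
move=> i j; rewrite !mxE [j == i]eq_sym.
case: eqP => [ji|_]; case: eqP => [ij|_] //; first by lia.
by case: eqP => [->|].
Qed.

Lemma bd_kernel_up n p (i j : 'I_n.+1) :
  j = i.+1 :> nat -> bd_kernel n p i j = p i.
Proof. by move=> ji; rewrite mxE ji eqxx. Qed.

Lemma bd_kernel_bd n p : birth_death (bd_kernel n p).
Proof.
move=> i j ij; rewrite mxE.
case: eqP => [?|_]; first by exfalso; lia.
case: eqP => [?|_]; first by exfalso; lia.
by case: eqP => // ij'; exfalso; move: ij; rewrite ij'; lia.
Qed.

Lemma bd_kernel_row_sum n p (i : 'I_n.+1) : \sum_j bd_kernel n p i j = 1.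
Proof.
have := bd_kernel_action n p (fun=> 1) i.
under eq_bigr => j _ do rewrite mulr1.
by move=> ->; rewrite !subrr !mulr0 !if_same !addr0.
Qed.

Lemma bd_kernel_stochastic n p : bd_feasible n p -> stochastic (bd_kernel n p).
Proof.
move=> [p01 p1]; split; last by move=> i; exact: bd_kernel_row_sum.
have p0 k : (k < n)%N -> 0 <= p k by move=> /p01 /andP[/ltW].
have p1' k : (k < n)%N -> p k <= 1 by move=> /p01 /andP[].
move=> i j; rewrite mxE; have := ltn_ord i; have := ltn_ord j; rewrite !ltnS.
case: eqP => [-> ? ?|_]; first by apply: p0.
case: eqP => [-> ? ?|_]; first by apply: p0.
case: eqP => // _ _; case: (nat_of_ord i) => [_|k kn] /=.
  case: eqP => [_|/eqP n0]; first by lra.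
  by have := p1' 0%N; rewrite lt0n eq_sym n0 => /(_ isT); lra.
case: eqP => [_|kn']; first by have := p1' k kn; lra.
by have := p1 k; rewrite ltn_neqAle kn andbT; move/eqP: kn' => -> /(_ isT); lra.
Qed.

Lemma bd_kernel_irreducible n p : bd_feasible n p -> irreducible (bd_kernel n p).
Proof.
move=> fp; have [p01 _] := fp; have [K0 _] := bd_kernel_stochastic _ _ fp.
set K := bd_kernel n p in K0 *.
have Kt0 t i j : 0 <= (K ^+ t) i j.
  elim: t i j => [|t IH] i j; first by rewrite expr0 mxE ler0n.
  rewrite exprS -mulmxE mxE; apply: sumr_ge0 => k _; exact: mulr_ge0.
have stepr t i k j : 0 < (K ^+ t) i k -> 0 < K k j -> 0 < (K ^+ t.+1) i j.
  move=> tik kj; rewrite exprSr -mulmxE mxE (bigD1 k)//= ltr_pwDl ?mulr_gt0//.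
  by apply: sumr_ge0 => l _; rewrite mulr_ge0.
have up (i : 'I_n.+1) (m : nat) : (i <= m)%N -> (m <= n)%N ->
    exists t, 0 < (K ^+ t) i (inord m).
  elim: m => [|m IH] im mn.
    exists 0%N; rewrite expr0 mxE -val_eqE/= inordK//.
    by move: im; rewrite leqn0 => /eqP ->; rewrite eqxx.
  move: im; rewrite leq_eqVlt => /orP[/eqP im|im].
    by exists 0%N; rewrite expr0 -im inord_val mxE eqxx.
  have [t tm] := IH im (ltnW mn); exists t.+1; apply: stepr tm _.
  have k1 : nat_of_ord (inord m : 'I_n.+1) = m by rewrite inordK// ltnS ltnW.
  have k2 : nat_of_ord (inord m.+1 : 'I_n.+1) = m.+1 by rewrite inordK.
  by rewrite bd_kernel_up ?k1 ?k2//; case/andP: (p01 m mn).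
have Kt_sym t i j : (K ^+ t) i j = (K ^+ t) j i.
  elim: t i j => [|t IH] i j; first by rewrite expr0 !mxE eq_sym.
  rewrite [in LHS]exprS [in RHS]exprSr -!mulmxE !mxE.
  by apply: eq_bigr => k _; rewrite (bd_kernel_sym n p) IH mulrC.
move=> i j; case: (leqP i j) => [ij|/ltnW ij].
  by have [t] := up i j ij (leq_ord j); rewrite inord_val; exists t.
by have [t] := up j i ij (leq_ord i); rewrite inord_val; exists t; rewrite Kt_sym.
Qed.

Lemma bd_kernel_chain n p : bd_feasible n p -> symmetric_bd_chain (bd_kernel n p).
Proof.
move=> fp; split; [exact: bd_kernel_stochastic | exact: bd_kernel_bd |
  exact: bd_kernel_sym | exact: bd_kernel_irreducible].
Qed.

(** Irreducibility forces positive rates: a vanishing rate at [k] would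
    disconnect the states up to [k] from those above. *)
Lemma symmetric_bd_chainP n (K : 'M[R]_n.+1) : symmetric_bd_chain K ->
  exists2 p, bd_feasible n p & K = bd_kernel n p.
Proof.
move=> [[K0 K1] Kbd Ksym Kirr].
pose p k := K (inord k) (inord k.+1).
have pE (i j : 'I_n.+1) : j = i.+1 :> nat -> K i j = p i.
  by move=> ji; rewrite /p inord_val -ji inord_val.
have K_off (i j : 'I_n.+1) : i != j -> K i j = bd_kernel n p i j.
  move=> ij; rewrite mxE (negPf ij).
  case: eqP => [/pE//|/eqP j1]; case: eqP => [ji|/eqP i1].
    by rewrite Ksym pE.
  by apply: Kbd; move: ij; rewrite -val_eqE /=; lia.
have KE : K = bd_kernel n p.
  apply/matrixP => i j; case: (eqVneq i j) => [<-|]; last exact: K_off.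
  have := K1 i; rewrite -(bd_kernel_row_sum n p i) (bigD1 i)//= [RHS](bigD1 i)//=.
  rewrite (eq_bigr (fun j => bd_kernel n p i j)); first exact: addIr.
  by move=> k; rewrite eq_sym; exact: K_off.
exists p => //; split => k kn.
  have k1 : val (inord k : 'I_n.+1) = k by rewrite /= inordK// ltnS ltnW.
  have k2 : val (inord k.+1 : 'I_n.+1) = k.+1 by rewrite /= inordK.
  rewrite lt_neqAle K0 andbT; apply/andP; split; last first.
    rewrite -(K1 (inord k)) (bigD1 (inord k.+1))//= lerDl; exact: sumr_ge0.
  apply/eqP => pk0.
  have cut t (i j : 'I_n.+1) : (i <= k < j)%N -> (K ^+ t) i j = 0.
    elim: t i j => [|t IH] i j ikj.
      by rewrite expr0 mxE -val_eqE/=; case: eqP => // ?; lia.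
    rewrite exprS -mulmxE mxE big1// => l _; case: (leqP l k) => lk.
      by rewrite (IH l) ?mulr0//; lia.
    case: (eqVneq (val l) (val i).+1) => /= li.
      rewrite (pE i l)//; have -> : val i = k by move=> /=; lia.
      by rewrite -pk0 mul0r.
    by rewrite Kbd ?mul0r//; apply/orP; left; move/eqP: li; lia.
  have [t] := Kirr (inord k) (inord k.+1).
  rewrite cut ?ltxx// -[X in (X <= _)%N]/(val _) k1 leqnn.
  by rewrite -[X in (_ < X)%N]/(val _) k2 ltnS leqnn.
have := K0 (inord k.+1) (inord k.+1); rewrite KE mxE inordK; last exact: ltnW.
by rewrite (ltn_eqF (ltnSn k.+1)) eqxx (ltn_eqF kn) /=; lra.
Qed.

(** Stationarity means that no net flow crosses any edge; the rates being
    positive and the kernel symmetric, neighbouring masses are equal. *)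
Lemma stationary_uniform n p (pi : 'rV[R]_n.+1) : bd_feasible n p ->
  stationary (bd_kernel n p) pi <-> pi = const_mx n.+1%:R^-1.
Proof.
move=> [p01 _]; have n0 : n.+1%:R != 0 :> R by [].
split; last first.
  move=> ->; split; first by move=> i; rewrite mxE invr_ge0.
    under eq_bigr => i _ do rewrite mxE.
    by rewrite sumr_const card_ord -[LHS]mulr_natr mulVf.
  apply/rowP => i; rewrite !mxE; under eq_bigr => j _ do rewrite mxE bd_kernel_sym.
  by rewrite -mulr_sumr bd_kernel_row_sum mulr1.
move=> [_ pi1 piK]; pose f (k : nat) : R := pi ord0 (inord k).
have balance (i : 'I_n.+1) :
    (if i == n :> nat then 0 else p i * (f i.+1 - f i))
    + (if i == 0%N :> nat then 0 else p i.-1 * (f i.-1 - f i)) = 0.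
  apply: (addrI (f i)); rewrite addrA -bd_kernel_action addr0.
  rewrite /f inord_val -[in RHS]piK mxE.
  by apply: eq_bigr => j _; rewrite inord_val bd_kernel_sym mulrC.
have f_step k : (k < n)%N -> f k.+1 = f k.
  elim: k => [|k IH] kn; have := balance (inord _); move=> /(_ _) bal.
    have := bal 0%N; rewrite inordK//= (ltn_eqF kn) addr0 => /eqP.
    have /andP[/lt0r_neq0 /negPf pk _] := p01 _ kn.
    by rewrite mulf_eq0 pk /= subr_eq0 => /eqP.
  have := bal k.+1; rewrite inordK ?ltnS 1?ltnW//= (ltn_eqF kn) IH 1?ltnW//.
  rewrite subrr mulr0 addr0 => /eqP.
  have /andP[/lt0r_neq0 /negPf pk _] := p01 _ kn.
  by rewrite mulf_eq0 pk /= subr_eq0 => /eqP ->.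
have f_const k : (k <= n)%N -> f k = f 0%N.
  by elim: k => // k IH kn; rewrite f_step// IH// ltnW.
have piE i : pi ord0 i = f 0%N by rewrite -(f_const i) ?leq_ord// /f inord_val.
apply/rowP => i; rewrite mxE piE; apply: (mulfI n0); rewrite mulfV// -[RHS]pi1.
under [RHS]eq_bigr => j _ do rewrite piE.
by rewrite sumr_const card_ord -[RHS]mulr_natl.
Qed.

(** The mean time to go from [0] to [x]: the stretch from [k] to [k.+1] takes
    [(k+1)/p k] on average. *)
Definition passage_time p (x : nat) : R := \sum_(k < x) k.+1%:R / p k.

(** Away from [n], one step of the chain increases [passage_time] by exactly
    one on average. *)
Lemma passage_time_action n p (i : 'I_n.+1) : bd_feasible n p ->
  \sum_j bd_kernel n p i j * passage_time p j =
  passage_time p i + if i == n :> nat then - n%:R else 1.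
Proof.
move=> [p01 _]; rewrite bd_kernel_action -addrA; congr (_ + _).
have p0 k : (k < n)%N -> p k != 0 by move=> /p01 /andP[/lt0r_neq0].
have phiS k : passage_time p k.+1 = passage_time p k + k.+1%:R / p k.
  by rewrite /passage_time big_ord_recr.
have up k : (k < n)%N ->
    p k * (passage_time p k.+1 - passage_time p k) = k.+1%:R.
  by move=> kn; rewrite phiS addrC addKr mulrC divfK// p0.
have down k : (k < n)%N ->
    p k * (passage_time p k - passage_time p k.+1) = - k.+1%:R.
  by move=> kn; rewrite -opprB mulrN up.
have := ltn_ord i; rewrite ltnS leq_eqVlt.
case: eqP => [-> _|_ /= i_lt].
  rewrite add0r; case: n p01 p0 up down {i} => [|n] p01 p0 up down /=.
    by rewrite oppr0.
  exact: down.
rewrite up//; case: (nat_of_ord i) i_lt => [|k] kn /=; first by rewrite addr0.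
by rewrite down 1?ltnW// -[k.+2%:R]natr1 addrAC subrr add0r.
Qed.

Lemma passage_time_mono n p x y : bd_feasible n p -> (x <= y <= n)%N ->
  passage_time p x <= passage_time p y.
Proof.
move=> [p01 _] /andP[]; elim: y => [|y IH]; first by rewrite leqn0 => /eqP ->.
rewrite leq_eqVlt => /orP[/eqP ->//|xy yn].
apply: le_trans (IH xy (ltnW yn)) _; rewrite /passage_time big_ord_recr/= lerDl.
by have /andP[p0 _] := p01 y yn; rewrite divr_ge0// ltW.
Qed.

(** The edge from [k] to [k.+1] is crossed on the way to each of the [n - k]
    states above it. *)
Lemma sum_passage_time n p :
  \sum_(x < n.+1) passage_time p x = bd_cost n p.
Proof.
rewrite /bd_cost /passage_time; elim: n => [|n IH].
  by rewrite big_ord_recl !big_ord0 addr0.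
rewrite big_ord_recr/= IH [RHS]big_ord_recr/= big_ord_recr/= addrA -big_split/=.
congr (_ + _); last by rewrite subSnn mulr1.
apply: eq_bigr => k _; rewrite subSn ?(ltnW (ltn_ord k))// -[(n - k).+1%:R]natr1.
by rewrite mulrDr mulr1 mulrDl.
Qed.

End BirthDeathKernels.

(** * Markov property for the enlarged filtration *)

Section RealProbability.
Context {R : realType} {d : measure_display} {Omega : measurableType d}.
Context (P : probability Omega R).
Implicit Types A B : set Omega.

Definition pr A : R := fine (P A).

Lemma prE A : measurable A -> P A = (pr A)%:E.
Proof. by move=> mA; rewrite /pr fineK// fin_num_measure. Qed.

Lemma pr_ge0 A : 0 <= pr A.
Proof. by rewrite /pr fine_ge0. Qed.

Lemma prU A B : measurable A -> measurable B -> A `&` B = set0 ->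
  pr (A `|` B) = pr A + pr B.
Proof.
move=> mA mB AB; apply: EFin_inj.
by rewrite EFinD -!prE//; [exact: measureU | exact: measurableU].
Qed.

Lemma le_pr A B : measurable A -> measurable B -> A `<=` B -> pr A <= pr B.
Proof. by move=> mA mB AB; rewrite -lee_fin -!prE// le_measure ?inE. Qed.

Lemma pr_setT : pr setT = 1.
Proof. by rewrite /pr probability_setT. Qed.

Lemma pr_partition (T : finType) (Y : Omega -> T) A :
  (forall i, measurable (Y @^-1` [set i])) -> measurable A ->
  pr A = \sum_i pr (A `&` Y @^-1` [set i]).
Proof.
move=> mY mA.
have seqP (s : seq T) : uniq s -> measurable (A `&` [set w | Y w \in s]) /\
    pr (A `&` [set w | Y w \in s]) = \sum_(i <- s) pr (A `&` Y @^-1` [set i]).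
  elim: s => [_|i s IH /= /andP[i_s /IH[ms prs]]].
    have -> : A `&` [set w | Y w \in [::]] = set0 by apply/seteqP; split => w [].
    by rewrite big_nil /pr measure0.
  have -> : A `&` [set w | Y w \in i :: s] =
      (A `&` Y @^-1` [set i]) `|` (A `&` [set w | Y w \in s]).
    apply/seteqP; split => w /=; rewrite inE.
      by move=> [Aw /orP[/eqP|]]; [left|right].
    by move=> [[Aw ->]|[Aw ->]]; rewrite ?eqxx ?orbT.
  split; first by apply: measurableU => //; exact: measurableI.
  rewrite big_cons -prs prU//; first exact: measurableI.
  apply/seteqP; split => w //= [[_ Yi] [_ Ys]].
  by move: i_s; rewrite -Yi Ys.
have [_ <-] := seqP _ (index_enum_uniq T).
by congr pr; apply/seteqP; split => w /=; [rewrite mem_index_enum|case].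
Qed.

End RealProbability.

Section MarkovProperty.
Context {R : realType} {n : nat} {d : measure_display} {Omega : measurableType d}.
Context (P : probability Omega R) (X : nat -> Omega -> 'I_n.+1).
Implicit Types (K : 'M[R]_n.+1) (A B : set Omega) (H : set (set Omega)).
Local Notation pr := (pr P).

Definition enlarged_filtration H t : set (set Omega) :=
  <<s sigma_upto X t `|` H >>.

Context (mX : forall t i, measurable (X t @^-1` [set i])).

Lemma history_zero x : history X x 0 = X 0%N @^-1` [set x 0%N].
Proof.
by apply/seteqP; split => [w /(_ 0%N)|w ? s]; [exact|rewrite leqn0 => /eqP ->].
Qed.

Lemma history_succ x t :
  history X x t.+1 = history X x t `&` X t.+1 @^-1` [set x t.+1].
Proof.
apply/seteqP; split => [w h|w [h /= h1] s].
  by split => [s ?|]; apply: h => //; exact: leqW.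
by rewrite leq_eqVlt => /orP[/eqP ->//|]; exact: h.
Qed.

Lemma measurable_history x t : measurable (history X x t).
Proof.
elim: t => [|t IH]; first by rewrite history_zero.
by rewrite history_succ; exact: measurableI.
Qed.

Lemma sigma_process_history x t : sigma_process X (history X x t).
Proof.
pose G := [set A | exists s i, A = X s @^-1` [set i]].
have GX s i : @measurable _ (g_sigma_algebraType G) (X s @^-1` [set i]).
  by apply: sub_sigma_algebra; exists s, i.
elim: t => [|t IH].
  by rewrite history_zero; exact: GX.
rewrite history_succ; exact: (@measurableI _ (g_sigma_algebraType G)).
Qed.

Lemma enlarged_filtration_measurable H t A : H `<=` measurable ->
  enlarged_filtration H t A -> measurable A.
Proof.
move=> mH; apply: smallest_sub; first exact: sigma_algebra_measurable.
move=> B [|/mH//]; apply: smallest_sub; first exact: sigma_algebra_measurable.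
by move=> C [s [i [_ ->]]].
Qed.

(** Up to time [t] the chain takes finitely many values, so a history is an
    atom of the chain's filtration.  Consequently an event of the enlarged
    filtration coincides, on each history, with an event of the extra
    randomness alone; the events with this property form a sigma-algebra. *)
Lemma enlarged_filtration_history H t A x : sigma_algebra setT H ->
  enlarged_filtration H t A ->
  exists2 B, H B & A `&` history X x t = B `&` history X x t.
Proof.
move=> [H0 HC HU] FA.
pose G := [set A | exists2 B, H B & A `&` history X x t = B `&` history X x t].
suff : enlarged_filtration H t `<=` G by apply.
have sG : sigma_algebra setT G.
  split; first by exists set0.
  - move=> C [B HB CB]; exists (setT `\` B); first exact: HC.
    rewrite !setTD; apply/seteqP; split => w /= [wn wh]; split => // wC; apply: wn.
      by have : (B `&` history X x t) w by []; rewrite -CB => -[].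
    by have : (C `&` history X x t) w by []; rewrite CB => -[].
  - move=> C GC; have [B BE] := choice (fun k =>
      let: ex_intro2 B HB E := GC k in ex_intro _ B (conj HB E)).
    exists (\bigcup_k B k); first by apply: HU => k; have [] := BE k.
    by rewrite !setI_bigcupl; apply: eq_bigcupr => k _; have [] := BE k.
apply: smallest_sub => // B [|HB]; last by exists B.
apply: smallest_sub => // C [s [i [st ->]]].
case: (eqVneq (x s) i) => [<-|xi].
  exists setT; first by rewrite -[setT]setD0; exact: HC.
  by rewrite setTI; apply: setIidr => w /(_ s st).
exists set0 => //; rewrite set0I; apply/seteqP; split => w //= [Xi].
by move=> /(_ s st); rewrite Xi => ix; move: xi; rewrite ix eqxx.
Qed.

(* A finite encoding of the paths up to time [t], to sum over histories. *)
Let path_of t (w : Omega) : {ffun 'I_t.+1 -> 'I_n.+1} := [ffun s : 'I_t.+1 => X s w].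
Let extend t (x : {ffun 'I_t.+1 -> 'I_n.+1}) (s : nat) : 'I_n.+1 :=
  x (inord s).

Let path_of_history t x : path_of t @^-1` [set x] = history X (extend t x) t.
Proof.
apply/seteqP; split => w /=.
  by move=> <- s st; rewrite /extend /path_of ffunE inordK.
move=> h; apply/ffunP => s; rewrite ffunE (h s); last by rewrite -ltnS.
by rewrite /extend inord_val.
Qed.

Lemma history_next K x0 H A x t j : markov_chain P K x0 X ->
  independent_randomness P X H -> enlarged_filtration H t A ->
  pr (A `&` history X x t `&` X t.+1 @^-1` [set j]) =
  pr (A `&` history X x t) * K (x t) j.
Proof.
move=> [_ _ step] [sH mH indep] FA.
have [B HB ->] := enlarged_filtration_history _ _ _ x sH FA.
have indep_hist y s : pr (B `&` history X y s) = pr (history X y s) * pr B.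
  apply: EFin_inj; rewrite EFinM -!prE; last 3 first.
  - exact: mH.
  - exact: measurable_history.
  - by apply: measurableI; [exact: mH | exact: measurable_history].
  rewrite setIC; apply: indep => //.
  exact: sigma_process_history.
pose y s := if (s <= t)%N then x s else j.
have hist_y s : (s <= t)%N -> history X y s = history X x s.
  move=> st; apply/seteqP; split => w h r rs; have := h r rs;
    by rewrite /y (leq_trans rs st).
have -> : B `&` history X x t `&` X t.+1 @^-1` [set j] = B `&` history X y t.+1.
  by rewrite -setIA history_succ hist_y// /y ltnn.
rewrite !indep_hist mulrAC; congr (_ * _); apply: EFin_inj.
rewrite EFinM -!prE; [|exact: measurable_history|exact: measurable_history].
by rewrite step hist_y// /y leqnn ltnn.
Qed.

(** Summation of [history_next] over the finitely many histories ending at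
    [i]. *)
Lemma markov_property K x0 H A t i j : markov_chain P K x0 X ->
  independent_randomness P X H -> enlarged_filtration H t A ->
  pr (A `&` X t @^-1` [set i] `&` X t.+1 @^-1` [set j]) =
  pr (A `&` X t @^-1` [set i]) * K i j.
Proof.
move=> chain indep FA; have [_ mH _] := indep.
have mA := enlarged_filtration_measurable _ _ _ mH FA.
have mpath x : measurable (path_of t @^-1` [set x]).
  by rewrite path_of_history; exact: measurable_history.
rewrite (pr_partition _ _ _ _ mpath); last by do ?apply: measurableI.
rewrite [X in _ = X * _](pr_partition _ _ _ _ mpath); last exact: measurableI.
rewrite mulr_suml; apply: eq_bigr => x _; rewrite path_of_history.
have xt : extend t x t = x ord_max.
  by rewrite /extend; congr (x _); apply: val_inj; rewrite /= inordK.
case: (eqVneq (x ord_max) i) => [xi|xi].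
  have hi : X t @^-1` [set i] `&` history X (extend t x) t =
      history X (extend t x) t.
    by apply: setIidr => w /(_ t (leqnn t)); rewrite xt xi.
  rewrite -setIA (setIC (X t.+1 @^-1` _)) setIA -[A `&` _ `&` _]setIA hi.
  by rewrite (history_next _ _ _ _ _ _ _ chain indep FA) xt xi.
have hi : X t @^-1` [set i] `&` history X (extend t x) t = set0.
  apply/seteqP; split => w //= [Xi /(_ t (leqnn t))].
  by rewrite xt Xi => /esym/eqP; rewrite (negPf xi).
rewrite -setIA (setIC (X t.+1 @^-1` _)) setIA -[A `&` _ `&` _]setIA hi.
by rewrite setI0 set0I /pr measure0 mul0r.
Qed.

Lemma chain_start K x0 : markov_chain P K x0 X ->
  forall y, pr (X 0%N @^-1` [set y]) = (y == x0)%:R.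
Proof.
move=> [_ X0 _] y; case: (eqVneq y x0) => [->|yx]; first by rewrite /pr X0.
apply/eqP; rewrite eq_le pr_ge0 andbT.
have := @le_pr _ _ _ P (X 0%N @^-1` [set y] `|` X 0%N @^-1` [set x0]) setT
  (measurableU _ _ (mX _ _) (mX _ _)) measurableT (fun=> fun=> Logic.I).
rewrite pr_setT prU//; first by rewrite {2}/pr X0 /= gerDr.
by apply/seteqP; split => w //= [Xy Xx0]; move: yx; rewrite -Xy Xx0 eqxx.
Qed.

End MarkovProperty.

Section StoppedProcess.
Context {R : realType} {n : nat} {d : measure_display} {Omega : measurableType d}.
Context (P : probability Omega R) (X : nat -> Omega -> 'I_n.+1).
Context (S : Omega -> option nat).
Implicit Types (K : 'M[R]_n.+1) (H : set (set Omega)).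
Local Notation pr := (pr P).

Definition running (t : nat) : set Omega :=
  [set w | if S w is Some s then (t < s)%N else True].

Definition stopped (t : nat) (w : Omega) : 'I_n.+1 :=
  X (if S w is Some s then minn s t else t) w.

Lemma runningC t :
  ~` running t = [set w | if S w is Some s then (s <= t)%N else false].
Proof.
apply/seteqP; split => w /=; rewrite /running/=; case: (S w) => //= s; last first.
  by rewrite leqNgt => /negP.
by move/negP; rewrite -leqNgt.
Qed.

Lemma running_filtration H t : sigma_algebra setT H ->
  stopping_time (enlarged_filtration X H) S ->
  enlarged_filtration X H t (running t).
Proof.
move=> sH /(_ t); rewrite -runningC => /sigma_algebraCD.
by rewrite setTD setCK.
Qed.

Lemma running_pr_nonincreasing s t : (forall t, measurable (running t)) ->
  (s <= t)%N -> pr (running t) <= pr (running s).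
Proof.
move=> mr st; apply: le_pr => // w; rewrite /running/=.
by case: (S w) => // r; exact: leq_ltn_trans.
Qed.

Lemma stopped_running t y :
  running t `&` stopped t @^-1` [set y] = running t `&` X t @^-1` [set y].
Proof.
apply/seteqP; split => w [] /=; rewrite /running /stopped/=;
  case: (S w) => //= s ts; rewrite (minn_idPr (ltnW ts))//.
Qed.

Lemma stopped_succ_running t y :
  running t `&` stopped t.+1 @^-1` [set y] = running t `&` X t.+1 @^-1` [set y].
Proof.
apply/seteqP; split => w [] /=; rewrite /running /stopped/=;
  case: (S w) => //= s ts; rewrite (minn_idPr ts)//.
Qed.

Lemma stopped_succ_frozen t y :
  ~` running t `&` stopped t.+1 @^-1` [set y] =
  ~` running t `&` stopped t @^-1` [set y].
Proof.
rewrite runningC; apply/seteqP; split => w [] /=; rewrite /stopped;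
  case: (S w) => //= s st; rewrite (minn_idPl st) (minn_idPl (leqW st))//.
Qed.

End StoppedProcess.

(** * Dynkin's formula and the lower bound *)

(** A nonincreasing summable sequence tends to zero: by monotonicity
    [t q_t] is at most the sum of the first [t] terms, hence at most [e].  This
    is how the remainders [P(S > t)] disappear in the limit. *)
Lemma summable_tail_le0 (R : realType) (q : nat -> R) (x c e : R) :
  (forall s t, (s <= t)%N -> q t <= q s) -> 0 <= c ->
  (forall t, \sum_(s < t) q s <= e) -> (forall t, x <= c * q t) -> x <= 0.
Proof.
move=> qmono c0 qe xq; rewrite leNgt; apply/negP => x0.
have bound t : t%:R * x <= c * e.
  apply: le_trans (ler_wpM2l c0 (qe t)); apply: (@le_trans _ _ (c * (q t *+ t))).
    by rewrite -[q t *+ t]mulr_natl mulrCA ler_wpM2l.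
  rewrite ler_wpM2l// -[X in _ *+ X]card_ord -sumr_const ler_sum// => s _.
  by apply: qmono; exact: ltnW.
have := bound (Num.truncn (c * e / x)).+1.
by rewrite leNgt -ltr_pdivrMr// truncnS_gt.
Qed.

Section DynkinFormula.
Context {R : realType} {n : nat} {d : measure_display} {Omega : measurableType d}.
Context (P : probability Omega R) (X : nat -> Omega -> 'I_n.+1).
Context (S : Omega -> option nat) (K : 'M[R]_n.+1) (x0 : 'I_n.+1).
Context (H : set (set Omega)).
Context (chain : markov_chain P K x0 X) (indep : independent_randomness P X H).
Context (stopS : stopping_time (enlarged_filtration X H) S).
Implicit Types g : 'I_n.+1 -> R.
Local Notation pr := (pr P).
Local Notation Z := (stopped X S).

Let mX t i : measurable (X t @^-1` [set i]).
Proof. by have [] := chain. Qed.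

Lemma measurable_running t : measurable (running S t).
Proof.
have [sH mH _] := indep; apply: enlarged_filtration_measurable mX _ _ _ mH _.
exact: running_filtration.
Qed.

Let split_stopped t y : Z t.+1 @^-1` [set y] =
  (running S t `&` X t.+1 @^-1` [set y]) `|`
  (~` running S t `&` Z t @^-1` [set y]).
Proof.
by rewrite -stopped_succ_running -stopped_succ_frozen -setIUl setUv setTI.
Qed.

Lemma stopped_zero : Z 0%N = X 0%N.
Proof.
by apply/funext => w; rewrite /stopped; case: (S w) => // s; rewrite minn0.
Qed.

Lemma measurable_stopped t y : measurable (Z t @^-1` [set y]).
Proof.
elim: t => [|t IH]; first by rewrite stopped_zero.
rewrite split_stopped; apply: measurableU; apply: measurableI => //.
  exact: measurable_running.
by apply: measurableC; exact: measurable_running.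
Qed.

(** The law of the process stopped at [S] changes only through the trajectories
    still running at time [t], which by the Markov property take one step of
    the kernel. *)
Lemma stopped_step t y :
  pr (Z t.+1 @^-1` [set y]) + pr (running S t `&` X t @^-1` [set y]) =
  pr (Z t @^-1` [set y]) + \sum_x pr (running S t `&` X t @^-1` [set x]) * K x y.
Proof.
have mr := measurable_running t; have mrC := measurableC mr.
have mZ := measurable_stopped.
have disj A B : (running S t `&` A) `&` (~` running S t `&` B) = set0.
  by rewrite setIACA setICr set0I.
rewrite split_stopped prU//; try exact: measurableI.
rewrite -[in RHS](setTI (Z t @^-1` _)) -(setUv (running S t)) setIUl.
rewrite stopped_running.
rewrite prU//; try exact: measurableI.
rewrite [RHS]addrC addrA [RHS]addrAC; congr (_ + _); rewrite [RHS]addrC.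
rewrite addrC; congr (_ + _).
rewrite (pr_partition _ _ _ _ (mX t)); last exact: measurableI.
apply: eq_bigr => x _; rewrite -setIA (setIC (X t.+1 @^-1` _)) setIA.
have [sH mH _] := indep.
apply: markov_property mX _ _ _ _ _ _ _ chain indep _; exact: running_filtration.
Qed.

Lemma sum_running t :
  \sum_x pr (running S t `&` X t @^-1` [set x]) = pr (running S t).
Proof. by rewrite -(pr_partition _ _ _ _ (mX t))//; exact: measurable_running. Qed.

Definition stopped_mean t g : R := \sum_y pr (Z t @^-1` [set y]) * g y.

Lemma stopped_mean_zero g : stopped_mean 0 g = g x0.
Proof.
rewrite /stopped_mean stopped_zero (bigD1 x0)//=.
rewrite (chain_start _ _ mX _ _ chain) eqxx mul1r.
rewrite big1 ?addr0// => y /negPf yx; rewrite (chain_start _ _ mX _ _ chain) yx.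
exact: mul0r.
Qed.

Lemma stopped_mean_succ t g : stopped_mean t.+1 g = stopped_mean t g +
  \sum_x pr (running S t `&` X t @^-1` [set x]) * (\sum_y K x y * g y - g x).
Proof.
rewrite /stopped_mean.
under [X in _ = _ + X]eq_bigr => x _ do rewrite mulrBr mulr_sumr.
rewrite sumrB exchange_big/= addrA -big_split/= -sumrB; apply: eq_bigr => y _.
under eq_bigr => x _ do rewrite mulrA.
rewrite -mulr_suml -mulrDl -stopped_step; ring.
Qed.

(** Dynkin's formula for a function whose mean drift is at most one: each step
    costs at most the probability of still running. *)
Lemma dynkin_le t g : (forall x, \sum_y K x y * g y <= g x + 1) ->
  stopped_mean t g <= g x0 + \sum_(s < t) pr (running S s).
Proof.
move=> Kg; elim: t => [|t IH]; first by rewrite stopped_mean_zero big_ord0 addr0.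
rewrite stopped_mean_succ [in leRHS]big_ord_recr/= addrA lerD// -sum_running.
apply: ler_sum => x _; rewrite -[leRHS]mulr1 ler_wpM2l ?pr_ge0//.
by rewrite lerBlDl.
Qed.

Lemma mean_timeE : mean_time P S = (\sum_(0 <= t <oo) (pr (running S t))%:E)%E.
Proof.
have mr := measurable_running.
transitivity (\int[P]_w (\sum_(0 <= t <oo) (\1_(running S t) w)%:E))%E.
  apply: eq_integral => w _.
  have runE t : \1_(running S t) w =
      ((if S w is Some s then (t < s)%N else true) : bool)%:R :> R.
    have wS : (w \in running S t) =
        if S w is Some s then (t < s)%N else true.
      by apply/idP/idP; rewrite in_setE /running/=; case: (S w).
    by rewrite indicE wS.
  transitivity (\sum_(0 <= t <oo)
      (((if S w is Some s then (t < s)%N else true) : bool)%:R : R)%:E)%E; last first.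
    by apply: eq_eseriesr => t _; rewrite runE.
  case: (S w) => [s|].
    rewrite (nneseries_split 0 s)// add0n eseries0 ?adde0.
      rewrite sumEFin; congr EFin.
      rewrite big_mkord (eq_bigr (fun=> 1)) ?sumr_const ?card_ord//.
      by move=> i _; rewrite ltn_ord.
    by move=> i si _; rewrite ltnNge si.
  apply/esym/eqyP => A A0.
  apply: le_trans (nneseries_lim_ge (Num.truncn A).+1 _) => //.
  rewrite sumEFin lee_fin big_mkord sumr_const card_ord.
  by rewrite ltW// truncnS_gt.
rewrite integral_nneseries//=; last first.
  by move=> t; apply/measurable_EFinP; exact: measurable_indic.
by apply: eq_eseriesr => t _; rewrite integral_indic// setIT -prE.
Qed.

Lemma measurable_at_stop y :
  measurable [set w | if S w is Some s then X s w = y else False].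
Proof.
have -> : [set w | if S w is Some s then X s w = y else False] =
    \bigcup_t (~` running S t `&` Z t @^-1` [set y]).
  apply/seteqP; split => [w /=|w [t _]].
    case E : (S w) => [s|//] Xs; exists s => //.
    by rewrite runningC /stopped/= E minnn.
  by rewrite runningC /stopped/= => -[]; case: (S w) => //= s /minn_idPl ->.
apply: bigcup_measurable => t _; apply: measurableI; last exact: measurable_stopped.
by apply: measurableC; exact: measurable_running.
Qed.

(** If [g] has drift at most one, a stopping time reaching the law [pi] must
    spend at least the mean increase of [g].  In [dynkin_le] the law of the
    stopped process differs from [pi] by at most [P(S > t)], which tends to zero
    when the mean time is finite. *)
Lemma mean_time_ge (pi : 'rV[R]_n.+1) g : (forall x, 0 <= g x) ->
  (forall x, \sum_y K x y * g y <= g x + 1) ->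
  stopped_law P X S pi ->
  ((\sum_y pi ord0 y * g y - g x0)%:E <= mean_time P S)%E.
Proof.
move=> g0 Kg law; rewrite mean_timeE.
set E := (\sum_(_ <= _ <oo) _)%E.
have E0 : (0 <= E)%E by apply: nneseries_ge0 => t _ _; rewrite lee_fin pr_ge0.
have sumE t : ((\sum_(s < t) pr (running S s))%:E <= E)%E.
  rewrite -sumEFin -(big_mkord xpredT (fun s => (pr (running S s))%:E)).
  by apply: nneseries_lim_ge => k _ _; rewrite lee_fin pr_ge0.
case: E E0 sumE => [e| |] // _ sumE; last by rewrite leey.
rewrite lee_fin -subr_le0.
apply: (@summable_tail_le0 _ (fun t => pr (running S t)) _ (\sum_y g y) e).
- by move=> s t; apply: running_pr_nonincreasing => r; exact: measurable_running.
- exact: sumr_ge0.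
- by move=> t; rewrite -lee_fin.
move=> t; have := dynkin_le t g Kg; have := sumE t; rewrite lee_fin.
have : \sum_y pi ord0 y * g y <=
    stopped_mean t g + (\sum_y g y) * pr (running S t).
  rewrite mulr_suml -big_split/=; apply: ler_sum => y _.
  rewrite [g y * _]mulrC -mulrDl ler_wpM2r//.
  have := law y; rewrite prE; last exact: measurable_at_stop.
  move=> [<-]; have mr := measurable_running t.
  apply: (@le_trans _ _ (pr (Z t @^-1` [set y] `\` running S t `|` running S t))).
    apply: le_pr; first exact: measurable_at_stop.
      by apply: measurableU => //; apply: measurableD => //; exact: measurable_stopped.
    move=> w /=; rewrite /stopped /running /=; case: (S w) => // s Xs.
    by case: (ltnP t s) => ts; [right|left; split => //; rewrite (minn_idPl ts)].
  rewrite prU//; last 2 first.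
  - by apply: measurableD => //; exact: measurable_stopped.
  - by rewrite setDKI.
  rewrite lerD2r; apply: le_pr; [|exact: measurable_stopped|exact: subDsetl].
  by apply: measurableD => //; exact: measurable_stopped.
lra.
Qed.

End DynkinFormula.

(** * Hitting times *)

Section HittingTime.
Context {n : nat} {Omega : Type}.
Implicit Types (X : nat -> Omega -> 'I_n.+1) (J : Omega -> 'I_n.+1).

(** The target may be random; a constant [J] gives the usual hitting times. *)
Definition hitting_time X J (w : Omega) : option nat :=
  match pselect (exists s, X s w == J w) with
  | left ex => Some (ex_minn ex)
  | right _ => None
  end.

Definition avoids X J (t : nat) : set Omega :=
  [set w | forall s, (s <= t)%N -> X s w <> J w].

Lemma avoids_succ X J t :
  avoids X J t.+1 = avoids X J t `\` [set w | X t.+1 w = J w].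
Proof.
apply/seteqP; split => [w av|w [av avt] s].
  by split; [move=> s st; apply: av; exact: leqW | exact: av].
by rewrite leq_eqVlt => /orP[/eqP ->//|]; exact: av.
Qed.

Lemma hitting_time_at X J w s : hitting_time X J w = Some s -> X s w = J w.
Proof.
by rewrite /hitting_time; case: pselect => // ex [<-]; case: ex_minnP => m /eqP.
Qed.

End HittingTime.

Section HittingTimeMeasurable.
Context {n : nat} {d : measure_display} {T : measurableType d}.
Implicit Types (X : nat -> T -> 'I_n.+1) (J : T -> 'I_n.+1).

Lemma running_hitting_time X J t : running (hitting_time X J) t = avoids X J t.
Proof.
apply/seteqP; split => w; rewrite /running /avoids /hitting_time/=;
    case: pselect => [ex|nex] //.
- case: ex_minnP => m _ mmin tm s st XJ.
  by have := mmin s; rewrite XJ eqxx => /(_ isT); rewrite leqNgt (leq_ltn_trans st tm).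
- by move=> _ s _ XJ; apply: nex; exists s; rewrite XJ.
- by case: ex_minnP => m /eqP XJ _ av; rewrite ltnNge; apply/negP => /av.
Qed.

(** Stated for an arbitrary measurable structure on [T], so that it applies
    to the sigma-algebra of the chain, to each level of the enlarged
    filtration, and to the measurable sets of the probability space. *)
Lemma measurable_avoids X J t :
  (forall s i, (s <= t)%N -> measurable (X s @^-1` [set i])) ->
  (forall i, measurable (J @^-1` [set i])) -> measurable (avoids X J t).
Proof.
move=> mX mJ.
have mXJ s : (s <= t)%N -> measurable [set w | X s w = J w].
  move=> st.
  have -> : [set w | X s w = J w] =
      \bigcup_(i in setT) (X s @^-1` [set i] `&` J @^-1` [set i]).
    by apply/seteqP; split => [w /= XJ|w [i _ [/= -> ->]]//]; exists (J w).
  apply: fin_bigcup_measurable => // i _.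
  by apply: measurableI => //; exact: mX.
have avE r : (r <= t)%N -> measurable (avoids X J r).
  elim: r => [|r IH] rt; last first.
    by rewrite avoids_succ; apply: measurableD; [exact: IH (ltnW rt) | exact: mXJ].
  have -> : avoids X J 0 = ~` [set w | X 0%N w = J w]; last exact/measurableC/mXJ.
  apply/seteqP; split => [w /(_ 0%N (leqnn _))//|w XJ s].
  by rewrite leqn0 => /eqP ->.
exact: avE.
Qed.
End HittingTimeMeasurable.

Section RandomizedHitting.
Context {n : nat} {d : measure_display} {Omega : measurableType d}.
Context (X : nat -> Omega -> 'I_n.+1).

Lemma avoids_sigma_process i t : sigma_process X (avoids X (fun=> i) t).
Proof.
set G := [set A | exists s i, A = X s @^-1` [set i]].
apply: (@measurable_avoids _ _ (g_sigma_algebraType G)) => [s j _|j].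
  by apply: sub_sigma_algebra; exists s, j.
by rewrite preimage_cst; case: ifP => _; [exact: measurableT|exact: measurable0].
Qed.

Lemma hitting_time_stopping (J : Omega -> 'I_n.+1) (H : set (set Omega)) :
  (forall i, H (J @^-1` [set i])) ->
  stopping_time (enlarged_filtration X H) (hitting_time X J).
Proof.
move=> HJ t; rewrite -runningC running_hitting_time.
apply: sigma_algebraC.
apply: (@measurable_avoids _ _ (g_sigma_algebraType (sigma_upto X t `|` H))).
  move=> s i st; apply: sub_sigma_algebra; left.
  by apply: sub_sigma_algebra; exists s, i.
by move=> i; apply: sub_sigma_algebra; right.
Qed.
End RandomizedHitting.

Section HittingMean.
Context {R : realType} {n : nat} {d : measure_display} {Omega : measurableType d}.
Context (P : probability Omega R) (X : nat -> Omega -> 'I_n.+1) (p : nat -> R).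
Context (H : set (set Omega)) (fp : bd_feasible n p).
Context (chain : markov_chain P (bd_kernel n p) ord0 X).
Context (indep : independent_randomness P X H).
Local Notation pr := (pr P).

Let mX t i : measurable (X t @^-1` [set i]).
Proof. by have [] := chain. Qed.

Let T (j : 'I_n.+1) := hitting_time X (fun=> j).

Let stopT j : stopping_time (enlarged_filtration X H) (T j).
Proof.
have [[H0 HC _] _ _] := indep; apply: hitting_time_stopping => i.
by rewrite preimage_cst; case: ifP => // _; rewrite -[setT]setD0; exact: HC.
Qed.

Let mZ j t y : measurable (stopped X (T j) t @^-1` [set y]).
Proof. exact: (measurable_stopped _ _ _ _ _ _ chain indep (stopT j)). Qed.

Let mr j t : measurable (running (T j) t).
Proof. exact: (measurable_running _ _ _ _ _ _ chain indep (stopT j)). Qed.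

Let running_below (j : 'I_n.+1) t :
  (forall y : 'I_n.+1, (j < y)%N -> pr (stopped X (T j) t @^-1` [set y]) = 0) ->
  forall x : 'I_n.+1, (j <= x)%N -> pr (running (T j) t `&` X t @^-1` [set x]) = 0.
Proof.
move=> below x; rewrite leq_eqVlt => /orP[/eqP/val_inj <-|jx].
  suff -> : running (T j) t `&` X t @^-1` [set j] = set0 by rewrite /pr measure0.
  by rewrite running_hitting_time; apply/seteqP; split => w // [/(_ t (leqnn t))].
apply/eqP; rewrite eq_le pr_ge0 andbT -stopped_running -(below x jx).
by apply: le_pr => //; exact: measurableI.
Qed.

(** Jumps have length at most one, so from states below [j] the chain reaches
    [j] before any state above it, and it is stopped there. *)
Lemma stopped_never_passes (j y : 'I_n.+1) t : (j < y)%N ->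
  pr (stopped X (T j) t @^-1` [set y]) = 0.
Proof.
elim: t y => [|t IH] y jy.
  rewrite stopped_zero (chain_start _ _ mX _ _ chain) -val_eqE/=.
  by rewrite gtn_eqF//; lia.
have run0 := running_below j t IH.
have := stopped_step _ _ _ _ _ _ chain indep (stopT j) t y.
rewrite run0 1?ltnW// IH// addr0 add0r => ->; apply: big1 => x _.
case: (leqP j x) => xj; first by rewrite run0 ?mul0r.
by rewrite bd_kernel_bd ?mulr0//; lia.
Qed.

(** Dynkin's formula for [passage_time]: before hitting [j] the chain stays
    below [j <= n], where the drift is exactly one, and the stopped process
    never exceeds [j]. *)
Lemma sum_avoids_le (j : 'I_n.+1) t :
  \sum_(s < t) pr (avoids X (fun=> j) s) <= passage_time p j.
Proof.
have run0 s :=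
  running_below j s (fun y => stopped_never_passes j y s).
have -> : \sum_(s < t) pr (avoids X (fun=> j) s) =
    stopped_mean P X (T j) t (fun y => passage_time p y).
  elim: t => [|t IH].
    by rewrite (stopped_mean_zero _ _ _ _ _ chain) /passage_time !big_ord0.
  rewrite big_ord_recr/= IH (stopped_mean_succ _ _ _ _ _ _ chain indep (stopT j)).
  congr (_ + _); rewrite -running_hitting_time.
  rewrite -(sum_running _ _ _ _ _ _ chain indep (stopT j)).
  apply: eq_bigr => x _; case: (leqP j x) => jx; first by rewrite run0 ?mul0r.
  rewrite passage_time_action// addrC addKr ltn_eqF ?mulr1//.
  by have := ltn_ord j; lia.
rewrite /stopped_mean; apply: (@le_trans _ _
    (\sum_y pr (stopped X (T j) t @^-1` [set y]) * passage_time p j)).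
  apply: ler_sum => y _; case: (leqP y j) => yj; last first.
    by rewrite stopped_never_passes ?mul0r.
  rewrite ler_wpM2l ?pr_ge0//; apply: passage_time_mono fp _.
  by rewrite yj -ltnS ltn_ord.
rewrite -mulr_suml; have -> : \sum_y pr (stopped X (T j) t @^-1` [set y]) = pr setT.
  rewrite (pr_partition _ _ (stopped X (T j) t))//.
  by apply: eq_bigr => y _; rewrite setTI.
by rewrite pr_setT mul1r.
Qed.

End HittingMean.

(** * A chain coded by a uniform point of the unit interval *)

Section UnitInterval.
Context (R : realType).

Definition unit_interval : set (measurableTypeR R) := [set` `[0 : R, 1[].

Lemma measurable_unit_interval : measurable unit_interval.
Proof. exact: measurable_itv. Qed.

Definition unit_lebesgue : set (measurableTypeR R) -> \bar R :=
  mrestr lebesgue_measure measurable_unit_interval.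

HB.instance Definition _ := Measure.on unit_lebesgue.

Lemma unit_lebesgue_setT : unit_lebesgue setT = 1%E.
Proof.
rewrite /unit_lebesgue /mrestr setTI lebesgue_measure_itv/= lte_fin ltr01.
by rewrite sube0.
Qed.

HB.instance Definition _ :=
  Measure_isProbability.Build _ _ _ unit_lebesgue unit_lebesgue_setT.

Lemma unit_lebesgue_itv (a l : R) :
  0 <= l -> [set` `[a, (a + l)[] `<=` unit_interval ->
  unit_lebesgue [set` `[a, (a + l)[] = l%:E.
Proof.
move=> l0 sub; rewrite /unit_lebesgue /mrestr (setIidl sub) lebesgue_measure_itv/=.
rewrite lte_fin ltrDl; case: ltP => [_|l0'].
  by rewrite -EFinB addrC addKr.
by congr EFin; apply/eqP; rewrite eq_le l0.
Qed.

End UnitInterval.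

Section IntervalCoding.
Context {R : realType} {n : nat} (K : 'M[R]_n.+1) (x0 : 'I_n.+1).
Context (stochK : stochastic K).
Implicit Types (x : nat -> 'I_n.+1) (u : R).

Let K0 i j : 0 <= K i j. Proof. by have [] := stochK. Qed.

Definition cumul (i : 'I_n.+1) (m : nat) : R := \sum_(z < n.+1 | (z < m)%N) K i z.

Let cumul_succ i (y : 'I_n.+1) : cumul i y.+1 = cumul i y + K i y.
Proof.
rewrite /cumul (bigD1 y)//= addrC; congr (_ + _); apply: eq_bigl => z.
by rewrite ltnS [RHS]ltn_neqAle andbC.
Qed.

Let cumul_mono i m m' : (m <= m')%N -> cumul i m <= cumul i m'.
Proof.
move=> mm; rewrite /cumul [leRHS](bigID (fun z : 'I_n.+1 => (z < m)%N))/=.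
rewrite [X in _ <= X + _](eq_bigl (fun z : 'I_n.+1 => (z < m)%N)).
  by rewrite lerDl sumr_ge0.
by move=> z; case: (ltnP z m) => zm; rewrite ?andbF// (leq_trans zm mm).
Qed.

Let cumul_zero i : cumul i 0 = 0.
Proof. by rewrite /cumul big_pred0. Qed.

Let cumul_last i : cumul i n.+1 = 1.
Proof.
have [_ K1] := stochK; rewrite /cumul -[RHS](K1 i).
by apply: eq_bigl => z; rewrite ltn_ord.
Qed.

(** A pair [c] stands for the interval [[c.1, c.1 + c.2[]; keeping the length
    rather than the right end makes it multiplicative along a path. *)
Definition cell_mem (c : R * R) u := c.1 <= u < c.1 + c.2.

(** The interval [c] is divided into consecutive pieces of relative lengths
    [K i j]; this is the piece of index [j]. *)
Definition subcell (c : R * R) (i j : 'I_n.+1) : R * R :=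
  (c.1 + c.2 * cumul i j, c.2 * K i j).

Fixpoint cell x (t : nat) : R * R :=
  if t is s.+1 then subcell (cell x s) (x s) (x t) else (0, 1).

(** The state at time [t] together with the cell of the history up to [t], which
    contains [u] when [u] lies in [[0, 1[]: the pieces of a cell cover it, so
    the pick succeeds. *)
Fixpoint code u (t : nat) : 'I_n.+1 * (R * R) :=
  if t is s.+1 then
    let: (i, c) := code u s in
    let j := odflt x0 [pick j | cell_mem (subcell c i j) u] in (j, subcell c i j)
  else (x0, (0, 1)).

(* Points outside the unit interval, a null set, follow the path of [0]. *)
Let unit_clip u : R := if 0 <= u < 1 then u else 0.

Definition coded_chain (t : nat) (u : measurableTypeR R) : 'I_n.+1 :=
  (code (unit_clip u) t).1.
Local Notation X := coded_chain.

Let code_cell u t : code u t = ((code u t).1, cell (fun s => (code u s).1) t).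
Proof. by elim: t => [|t IH] //=; rewrite IH. Qed.

Let subcell_exists c i u : cell_mem c u -> exists j, cell_mem (subcell c i j) u.
Proof.
move=> /andP[cu uc]; apply: contrapT => none.
have low m : (m <= n.+1)%N -> c.1 + c.2 * cumul i m <= u.
  elim: m => [|m IH] mn; first by rewrite cumul_zero mulr0 addr0.
  rewrite leNgt; apply/negP => um; apply: none; exists (Ordinal mn).
  rewrite /cell_mem/= IH 1?ltnW//= -addrA -mulrDr.
  by rewrite -[m]/(nat_of_ord (Ordinal mn)) -cumul_succ.
have := low n.+1 (leqnn _); rewrite cumul_last mulr1; lra.
Qed.

Let subcell_uniq c i u j j' : 0 <= c.2 ->
  cell_mem (subcell c i j) u -> cell_mem (subcell c i j') u -> j = j'.
Proof.
move=> c0; wlog jj : j j' / (j <= j')%N.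
  by move=> W; case: (leqP j j') => [|/ltnW] jj uj uj'; [exact: W|exact/esym/W].
move=> /andP[_ uj] /andP[uj' _]; apply: val_inj; apply/eqP; rewrite eqn_leq jj/=.
rewrite leqNgt; apply/negP => {}jj; move: uj uj' => /=.
rewrite -addrA -mulrDr -cumul_succ.
have := ler_wpM2l c0 (cumul_mono i _ _ jj); lra.
Qed.

Let subcell_sub c i j u : 0 <= c.2 -> cell_mem (subcell c i j) u -> cell_mem c u.
Proof.
move=> c0 /andP[]/=; rewrite -addrA -mulrDr -cumul_succ /cell_mem => lo hi.
have := ler_wpM2l c0 (cumul_mono i 0 j (leq0n _)); rewrite cumul_zero mulr0.
have := ler_wpM2l c0 (cumul_mono i j.+1 n.+1 (ltn_ord j)); rewrite cumul_last mulr1.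
by move=> ? ?; apply/andP; split; lra.
Qed.

Let cell_ge0 x t : 0 <= (cell x t).2.
Proof. by elim: t => [|t IH] //=; rewrite mulr_ge0. Qed.

Let cell_unit x t u : cell_mem (cell x t) u -> 0 <= u < 1.
Proof.
elim: t => [|t IH]; first by rewrite /cell_mem/= add0r.
by move=> /subcell_sub - /(_ (cell_ge0 _ _)) /IH.
Qed.

Let code_mem u t : 0 <= u < 1 -> cell_mem (cell (fun s => (code u s).1) t) u.
Proof.
move=> u01; elim: t => [|t IH]; first by rewrite /cell_mem/= add0r.
rewrite /= code_cell/=; case: pickP => [j //|none].
by have [j] := subcell_exists _ (code u t).1 _ IH; rewrite none.
Qed.

Let cell_eq x y t : (forall s, (s <= t)%N -> x s = y s) -> cell x t = cell y t.
Proof.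
elim: t => [//|t IH] xy /=.
by rewrite IH => [|s st]; rewrite ?xy//; exact: leqW.
Qed.

(** A point follows the path [x] up to time [t] exactly when it lies in the
    cell of [x]; the measure of this cell is the product of the transition
    probabilities. *)
Lemma code_history u x t : 0 <= u < 1 ->
  (forall s, (s <= t)%N -> (code u s).1 = x s) <->
  x 0%N = x0 /\ cell_mem (cell x t) u.
Proof.
move=> u01; split=> [h|[xx0]].
  split; first by rewrite -h.
  by rewrite -(cell_eq _ _ _ h); exact: code_mem.
elim: t => [_ s|t IH ut s]; first by rewrite leqn0 => /eqP ->; rewrite xx0.
have {}IH := IH (subcell_sub _ _ _ _ (cell_ge0 _ _) ut).
rewrite leq_eqVlt => /orP[/eqP -> {s}|]; last exact: IH.
have := code_mem u t.+1 u01; rewrite [cell _ _]/= (cell_eq _ _ _ IH) (IH t)//.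
by move=> /subcell_uniq; apply => //; exact: cell_ge0.
Qed.

Let cell_itv x t : [set u | cell_mem (cell x t) u] =
  [set` `[(cell x t).1, ((cell x t).1 + (cell x t).2)[].
Proof. by apply/seteqP; split => u /=; rewrite in_itv. Qed.

Let history_unit x t : x 0%N = x0 ->
  history X x t `&` unit_interval R = [set u | cell_mem (cell x t) u].
Proof.
move=> xx0; apply/seteqP; split => [u [h]|u ut].
  rewrite /unit_interval /= in_itv/= => u01.
  apply: (proj2 ((code_history _ _ _ u01).1 _)) => s st.
  by rewrite -h// /X /unit_clip u01.
have u01 := cell_unit _ _ _ ut.
split; last by rewrite /unit_interval/= in_itv.
by move=> s st; rewrite /X /unit_clip u01; apply: (code_history _ _ _ u01).2 st.
Qed.

Let history_wrong x t : x 0%N != x0 -> history X x t = set0.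
Proof.
move=> xx0; apply/seteqP; split => u // /(_ 0%N (leq0n _)) /= /esym x0x.
by move: xx0; rewrite x0x eqxx.
Qed.

Let measurable_history_coded x t : measurable (history X x t).
Proof.
case: (eqVneq (x 0%N) x0) => [xx0|/history_wrong ->]; last exact: measurable0.
rewrite -[history X x t]setIT -(setUv (unit_interval R)) setIUr history_unit//.
apply: measurableU; first by rewrite cell_itv; exact: measurable_itv.
have mC := measurableC (measurable_unit_interval R).
case: (pselect (history X x t (0 : R))) => [h0|nh0].
  rewrite (_ : _ `&` _ = ~` unit_interval R)//; apply: setIidr => u /= nu s st.
  rewrite -(h0 s st) /X /unit_clip lexx ltr01 /=.
  by case: ifP => // u01; exfalso; apply: nu; rewrite /unit_interval/= in_itv.
rewrite (_ : _ `&` _ = set0); first exact: measurable0.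
apply/seteqP; split => u // [h /= nu]; apply: nh0 => s st.
rewrite -(h s st) /X /unit_clip lexx ltr01 /=.
by case: ifP => // u01; exfalso; apply: nu; rewrite /unit_interval/= in_itv.
Qed.

Let unit_lebesgue_history x t : x 0%N = x0 ->
  unit_lebesgue R (history X x t) = ((cell x t).2)%:E.
Proof.
move=> xx0; transitivity (unit_lebesgue R (history X x t `&` unit_interval R)).
  by rewrite /unit_lebesgue /mrestr -setIA setIid.
rewrite history_unit// cell_itv; apply: unit_lebesgue_itv => //.
by rewrite -cell_itv => u /= /cell_unit; rewrite /unit_interval/= in_itv.
Qed.

Lemma markov_chain_coded : markov_chain (unit_lebesgue R) K x0 X.
Proof.
split.
- move=> t i.
  pose ext (x : {ffun 'I_t.+1 -> 'I_n.+1}) (s : nat) := x (inord s).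
  have -> : X t @^-1` [set i] =
      \bigcup_(x in [set x : {ffun 'I_t.+1 -> 'I_n.+1} | ext x t = i])
        history X (ext x) t.
    apply/seteqP; split => [u /= Xi|u [x /= <-]]; last exact.
    exists [ffun s : 'I_t.+1 => X s u]; first by rewrite /ext/= ffunE inordK.
    by move=> s st; rewrite /ext ffunE inordK.
  by apply: fin_bigcup_measurable; [exact: finite_finset|].
- rewrite -[RHS](unit_lebesgue_setT R); congr (unit_lebesgue R _).
  by apply/seteqP.
- move=> x t; case: (eqVneq (x 0%N) x0) => [xx0|xx0].
    rewrite -[LHS]/(unit_lebesgue R _) -[X in (X * _)%E]/(unit_lebesgue R _).
    by rewrite !unit_lebesgue_history// -EFinM.
  by rewrite !history_wrong// measure0 mul0e.
Qed.

End IntervalCoding.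

(** * The value of the mixing time *)

Section ProductSpace.
Context {R : realType} {n : nat} {d1 d2 : measure_display}.
Context {T1 : measurableType d1} {T2 : measurableType d2}.
Context (P1 : probability T1 R) (P2 : probability T2 R).
Context (X : nat -> T1 -> 'I_n.+1).

Definition lift_fst (t : nat) (w : T1 * T2) : 'I_n.+1 := X t w.1.

Definition snd_events : set (set (T1 * T2)) :=
  preimage_set_system setT snd measurable.

Let prod1 A : measurable A -> (P1 \x P2)%E (A `*` setT) = P1 A.
Proof.
move=> mA; transitivity (P1 A * P2 setT)%E; first exact: product_measure1E.
by rewrite probability_setT mule1.
Qed.

Let lift_preimage t i : lift_fst t @^-1` [set i] = (X t @^-1` [set i]) `*` setT.
Proof. by apply/seteqP; split => w //= []. Qed.

Let lift_history x t : history lift_fst x t = history X x t `*` setT.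
Proof. by apply/seteqP; split => w //= []. Qed.

Lemma markov_chain_lift K x0 : markov_chain P1 K x0 X ->
  markov_chain (P1 \x P2)%E K x0 lift_fst.
Proof.
move=> [mX X0 step]; split.
- by move=> t i; rewrite lift_preimage; exact: measurableX.
- by rewrite lift_preimage; exact: eq_trans (prod1 _ (mX _ _)) X0.
- move=> x t; rewrite !lift_history.
  have mh s := @measurable_history _ _ _ X mX x s.
  by rewrite [LHS]prod1// [X in (X * _)%E]prod1// step.
Qed.

Lemma independent_snd K x0 : markov_chain P1 K x0 X ->
  independent_randomness (P1 \x P2)%E lift_fst snd_events.
Proof.
move=> [mX _ _].
have sub : sigma_process lift_fst `<=` preimage_set_system setT fst measurable.
  apply: smallest_sub.
    by apply: sigma_algebra_preimage; exact: sigma_algebra_measurable.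
  move=> A [s [i ->]]; exists (X s @^-1` [set i]) => //.
  by rewrite setTI.
split.
- by apply: sigma_algebra_preimage; exact: sigma_algebra_measurable.
- move=> A [B mB <-]; rewrite setTI.
  have -> : snd @^-1` B = [set: T1] `*` B by apply/seteqP; split => w //= [].
  exact: measurableX.
- move=> A B /sub[A' mA' <-] [B' mB' <-]; rewrite !setTI.
  have -> : fst @^-1` A' = A' `*` [set: T2] by apply/seteqP; split => w //= [].
  have -> : snd @^-1` B' = [set: T1] `*` B' by apply/seteqP; split => w //= [].
  rewrite -setXI setTI setIT.
  transitivity (P1 A' * P2 B')%E; first exact: product_measure1E.
  congr (_ * _)%E; first exact/esym/prod1.
  transitivity (P1 setT * P2 B')%E; last exact/esym/product_measure1E.
  by rewrite probability_setT mul1e.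
Qed.

End ProductSpace.

Section MixingTimeValue.
Context {R : realType} (n : nat) (p : nat -> R) (fp : bd_feasible n p).
Local Notation K := (bd_kernel n p).
Local Notation value := (bd_cost n p / n.+1%:R).

Lemma mean_passage_time :
  \sum_(y < n.+1) n.+1%:R^-1 * passage_time p y = value.
Proof. by rewrite -mulr_sumr sum_passage_time mulrC. Qed.

(** The lower bound [mean_time_ge] for [passage_time], whose drift is at most
    one everywhere. *)
Lemma Tmix_ge : (value%:E <= Tmix K ord0)%E.
Proof.
apply/ereal_infP => _ [d [Om [P [X [S [pi [chain rst pist law ->]]]]]]].
have [H indep stopS] := rst.
have -> : value =
    \sum_y pi ord0 y * passage_time p y - passage_time p (@ord0 n).
  rewrite [X in _ - X]/passage_time big_ord0 subr0 -mean_passage_time.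
  move/(stationary_uniform _ _ _ fp): pist => ->.
  by apply: eq_bigr => y _; rewrite mxE.
apply: (mean_time_ge _ _ _ _ _ _ chain indep stopS pi (fun y => passage_time p y)).
- move=> y; rewrite -[0](_ : passage_time p 0 = 0).
    by apply: (passage_time_mono n) => //; rewrite leq0n -ltnS ltn_ord.
  by rewrite /passage_time big_ord0.
- move=> y; rewrite passage_time_action// lerD2l; case: ifP => // _.
- exact: law.
Qed.

Section RandomTarget.
Context {d : measure_display} {Omega : measurableType d}.
Context (P : probability Omega R) (X : nat -> Omega -> 'I_n.+1).
Context (J : Omega -> 'I_n.+1) (H : set (set Omega)).
Context (chain : markov_chain P K ord0 X) (indep : independent_randomness P X H).
Context (HJ : forall i, H (J @^-1` [set i])).
Context (unifJ : forall i, pr P (J @^-1` [set i]) = n.+1%:R^-1).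
Local Notation S := (hitting_time X J).

Let stopS : stopping_time (enlarged_filtration X H) S.
Proof. exact: hitting_time_stopping. Qed.

Let mr t : measurable (running S t).
Proof. exact: (measurable_running _ _ _ _ _ _ chain indep stopS). Qed.

Let mJ i : measurable (J @^-1` [set i]).
Proof. by have [_ mH _] := indep; exact: mH. Qed.

(** Conditioning on the target, which is independent of the chain. *)
Lemma pr_running_target t : pr P (running S t) =
  \sum_i n.+1%:R^-1 * pr P (avoids X (fun=> i) t).
Proof.
rewrite (pr_partition _ _ _ _ mJ)//; apply: eq_bigr => i _.
have -> : running S t `&` J @^-1` [set i] =
    avoids X (fun=> i) t `&` J @^-1` [set i].
  rewrite running_hitting_time; apply/seteqP.
  by split => w [av /= Ji]; split => // s /av; rewrite Ji.
have [sH mH ind] := indep; have [mX _ _] := chain.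
have mav : measurable (avoids X (fun=> i) t).
  apply: measurable_avoids => // j.
  by rewrite preimage_cst; case: ifP.
apply: EFin_inj; rewrite -(unifJ i) mulrC EFinM -!prE//; last exact: measurableI.
by apply: ind => //; exact: avoids_sigma_process.
Qed.

Let sum_running_le t : \sum_(s < t) pr P (running S s) <= value.
Proof.
under eq_bigr => s _ do rewrite pr_running_target.
rewrite exchange_big/= -mean_passage_time; apply: ler_sum => i _.
rewrite -mulr_sumr ler_wpM2l ?invr_ge0//.
exact: (sum_avoids_le _ _ _ _ fp chain indep).
Qed.

Lemma mean_hitting_target_le : (mean_time P S <= value%:E)%E.
Proof.
rewrite (mean_timeE _ _ _ _ _ _ chain indep stopS).
apply: lime_le; first by apply: is_cvg_nneseries => t _ _; rewrite lee_fin pr_ge0.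
by apply: nearW => t; rewrite big_mkord sumEFin lee_fin.
Qed.

(** On [S < oo] the stopped chain sits at [J], which is uniform; and [S] is almost
    surely finite because its mean is. *)
Lemma law_at_target : stopped_law P X S (const_mx n.+1%:R^-1).
Proof.
move=> i; rewrite mxE -(unifJ i).
pose A := [set w | if S w is Some s then X s w = i else False]; rewrite -/A.
have mA : measurable A := measurable_at_stop _ _ _ _ _ _ chain indep stopS i.
have AJ : A = J @^-1` [set i] `&` [set w | S w <> None].
  apply/seteqP; rewrite /A; split => w /=; case E: (S w) => [s|]//.
  - by move=> <-; rewrite (hitting_time_at _ _ _ _ E).
  - by rewrite (hitting_time_at _ _ _ _ E) => -[].
  - by case.
rewrite (prE P A mA); congr EFin; apply/eqP; rewrite eq_le; apply/andP; split.
  by apply: le_pr => //; rewrite AJ; exact: subIsetl.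
rewrite -subr_le0.
apply: (@summable_tail_le0 _ (fun t => pr P (running S t)) _ 1 value) => //.
  by move=> s t; exact: running_pr_nonincreasing.
move=> t; rewrite mul1r lerBlDl.
apply: (@le_trans _ _ (pr P (A `|` (running S t `\` A)))).
  apply: le_pr => //; first by apply: measurableU => //; exact: measurableD.
  move=> w Ji; case: (pselect (A w)) => Aw; [by left|right; split => //].
  by rewrite /running/=; case E: (S w) => [s|//]; exfalso; apply: Aw; rewrite AJ /= E.
rewrite prU//; [|exact: measurableD|by rewrite setIC setDKI].
by rewrite lerD2l; apply: le_pr; [exact: measurableD| |exact: subDsetl].
Qed.

End RandomTarget.

(** The target is the state at time one of a second chain, whose kernel has all
    entries [1/(n+1)]; the two chains live on the factors of a product of two
    unit intervals. *)
Lemma Tmix_le : (Tmix K ord0 <= value%:E)%E.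
Proof.
pose U : 'M[R]_n.+1 := const_mx n.+1%:R^-1.
have stochU : stochastic U.
  split=> [i j|i]; first by rewrite mxE invr_ge0.
  under eq_bigr => j _ do rewrite mxE.
  by rewrite sumr_const card_ord -[LHS]mulr_natr mulVf.
have stochK := bd_kernel_stochastic _ _ fp.
pose P1 : probability _ R := unit_lebesgue R.
have chainX : markov_chain P1 K ord0 (coded_chain K ord0) :=
  markov_chain_coded _ _ stochK.
have chainU : markov_chain P1 U ord0 (coded_chain U ord0) :=
  markov_chain_coded _ _ stochU.
pose P : probability _ R := (P1 \x P1)%E.
pose X := @lift_fst n _ _ _ (measurableTypeR R) (coded_chain K (@ord0 n)).
pose J (w : measurableTypeR R * measurableTypeR R) := coded_chain U (@ord0 n) 1 w.2.
have chain : markov_chain P K ord0 X by exact: markov_chain_lift.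
have indep := independent_snd P1 P1 _ _ _ chainX.
have mU i : measurable (coded_chain U ord0 1 @^-1` [set i]) by case: chainU.
have HJ i : snd_events (J @^-1` [set i]).
  by exists (coded_chain U ord0 1 @^-1` [set i]) => //; rewrite setTI.
have unifJ i : pr P (J @^-1` [set i]) = n.+1%:R^-1.
  pose x s : 'I_n.+1 := if s is 0%N then ord0 else i.
  have JE : J @^-1` [set i] = setT `*` history (coded_chain U ord0) x 1.
    apply/seteqP; split => w /=; rewrite /J; last by move=> [_ /(_ 1%N (leqnn _))].
    by move=> Ji; split => // -[|[|]].
  rewrite /pr JE; have [mV V0 step] := chainU.
  have mh := measurable_history _ mV x 1.
  rewrite (_ : P _ = (P1 setT * P1 (history (coded_chain U ord0) x 1))%E); last first.
    exact: product_measure1E.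
  by rewrite probability_setT mul1e step history_zero V0 mul1e mxE.
apply: le_trans (mean_hitting_target_le _ _ _ _ chain indep HJ unifJ).
apply: ereal_inf_lbound; exists _, _, P, X, (hitting_time X J), (const_mx n.+1%:R^-1).
split => //.
- exists (@snd_events _ _ (measurableTypeR R) (measurableTypeR R)) => //.
  exact: hitting_time_stopping.
- exact/(stationary_uniform _ _ _ fp).
- exact: (law_at_target _ _ _ _ chain indep HJ unifJ).
Qed.

Lemma Tmix_bd_kernel : Tmix K ord0 = value%:E.
Proof. by apply/eqP; rewrite eq_le Tmix_le Tmix_ge. Qed.

End MixingTimeValue.

(** * Uniqueness of the minimiser *)

Section UniqueMinimizer.
Context {R : realType}.
Implicit Types (n : nat) (p a : nat -> R).

Lemma eq_bd_kernel n p a : (forall k, (k < n)%N -> p k = a k) ->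
  bd_kernel n p = bd_kernel n a.
Proof.
move=> pa; apply/matrixP => i j; rewrite !mxE.
have := ltn_ord i; have := ltn_ord j; rewrite !ltnS => jn le_in.
case: eqP => [ji|_]; first by rewrite pa// -ji.
case: eqP => [ij|_]; first by rewrite pa// -ij.
case: eqP => // _; congr (_ - _ - _); case: eqP => // /eqP i_ne; apply: pa; lia.
Qed.

(** Every symmetric birth-and-death chain has the form [bd_kernel n p], and its
    mixing time is proportional to [bd_cost n p]. *)
Lemma unique_minimizer_of_cost n a : bd_feasible n a ->
  (forall p, bd_feasible n p ->
     bd_cost n a <= bd_cost n p ?= iff [forall k : 'I_n, p k == a k]) ->
  unique_Tmix_minimizer (bd_kernel n a).
Proof.
move=> fa amin K'.
have cost_le p : bd_feasible n p ->
    (Tmix (bd_kernel n a) ord0 <= Tmix (bd_kernel n p) ord0)%E.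
  move=> fp; rewrite !Tmix_bd_kernel// lee_fin ler_wpM2r ?invr_ge0//.
  exact: amin.
split=> [[/symmetric_bd_chainP[p fp ->] pmin]|->]; last first.
  split; first exact: bd_kernel_chain.
  by move=> K'' /symmetric_bd_chainP[p fp ->]; exact: cost_le.
have := pmin _ (bd_kernel_chain _ _ fa).
rewrite !Tmix_bd_kernel// lee_fin ler_pM2r ?invr_gt0// (ge_leif (amin p fp)).
move=> /forallP pa; apply: eq_bd_kernel => k kn.
exact/eqP/(pa (Ordinal kn)).
Qed.

(** For [n = 1] the only rate is [1 - theta R 1 = 1]. *)
Lemma theta1 : theta R 1 = 0.
Proof.
rewrite /theta /theta_pred; have -> : 2%:R ^+ 2 - 4 = 0 :> R by ring.
by rewrite mulr0 sqrtr0 subrr mulr0.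
Qed.

(** With a single edge there is no pair constraint, and the minimum is attained
    where the rate is maximal. *)
Lemma bd_cost_min_1 p a : a 0%N = 1 -> bd_feasible 1 p ->
  bd_cost 1 a <= bd_cost 1 p ?= iff [forall k : 'I_1, p k == a k].
Proof.
move=> a1 [/(_ 0%N isT) /andP[p0 p1] _].
rewrite /bd_cost !big_ord1/= subn0 !mul1r a1 invr1.
have -> : [forall k : 'I_1, p k == a k] = (p 0%N == 1).
  by apply/forallP/eqP => [/(_ ord0)/eqP -> //|p01 k]; rewrite ord1 a1 p01.
split; first by rewrite -[leLHS]invr1 lef_pV2 ?posrE.
by rewrite -[X in X == _]invr1 (inj_eq invr_inj) eq_sym.
Qed.

End UniqueMinimizer.

Theorem theorem6p5 (R : realType) (n : nat) :
  ((2 <= n)%N -> ~~ odd n ->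
     unique_Tmix_minimizer (bd_kernel n (fun _ : nat => 2^-1 : R))) /\
  (odd n ->
     unique_Tmix_minimizer
       (bd_kernel n (fun k : nat => if odd k then theta R n else 1 - theta R n))).
Proof.
split=> [_ evn|oddn]; refine (unique_minimizer_of_cost _ _ _ _).
- by split=> k _; lra.
- by move=> p; exact: bd_cost_min_even.
- case: (ltnP 2 n) => n2.
    have [th0 th1 _] := @theta_balance R n n2.
    by split=> k _ /=; case: (odd k) => /=; lra.
  have -> : n = 1%N by lia.
  by rewrite theta1; split => // k; rewrite ltnS leqn0 => /eqP -> /=; lra.
- move=> p fp; case: (ltnP 2 n) => n2; first exact: bd_cost_min_odd.
  have n1 : n = 1%N by lia.
  by subst n; apply: bd_cost_min_1; rewrite // theta1 subr0.
Qed.
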